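(* Let $\mathbf{A}$ be a subspace of dimension $k$ and $\mathbf{B}$ a subspace of dimension $l$ in $\mathbb{R}^n$, and suppose $k \le l \le n$. Then $$d_{\operatorname{Gr}(k,n)}\bigl(\mathbf{A}, \Omega_{-}(\mathbf{B})\bigr) = d_{\operatorname{Gr}(l,n)}\bigl(\mathbf{B}, \Omega_{+}(\mathbf{A})\bigr),$$ i.e. $\min_{\mathbf{Y}\in\Omega_{-}(\mathbf{B})} d_{\operatorname{Gr}(k,n)}(\mathbf{A},\mathbf{Y}) = \min_{\mathbf{X}\in\Omega_{+}(\mathbf{A})} d_{\operatorname{Gr}(l,n)}(\mathbf{B},\mathbf{X})$. Their common value defines a distance $\delta(\mathbf{A},\mathbf{B})$ between the two subspaces with the following properties: (i) $\delta(\mathbf{A},\mathbf{B})$ is independent of the dimension $n$ of the ambient space and is the same for all $n \ge l+1$ (that is, its value is unchanged when $\mathbf{A},\mathbf{B}\subseteq\mathbb{R}^n$ are regarded as subspaces of $\mathbb{R}^m$, $m \ge n$, via the inclusion $x \mapsto (x,0)$); (ii) $\delta(\mathbf{A},\mathbf{B})$ reduces to the Grassmann distance $d_{\operatorname{Gr}(k,n)}(\mathbf{A},\mathbf{B})$ when $k=l$; (iii) $\delta(\mathbf{A},\mathbf{B})$ may be computed explicitly as $$\delta(\mathbf{A},\mathbf{B}) = \Bigl(\sum_{i=1}^{\min\{k,l\}} \theta_i(\mathbf{A},\mathbf{B})^2\Bigr)^{1/2},$$ where $\theta_i(\mathbf{A},\mathbf{B})$ is the $i$th principal angle between $\mathbf{A}$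 and $\mathbf{B}$, $i=1,\dots,\min(k,l)$.
   Context: $\operatorname{Gr}(k,n)$ is the Grassmannian of $k$-dimensional linear subspaces of $\mathbb{R}^n$; $k,l,n$ are positive integers. Principal angles: for subspaces $\mathbf{A},\mathbf{B}$ of $\mathbb{R}^n$ of dimensions $k,l$, let $A \in \mathbb{R}^{n\times k}$, $B\in\mathbb{R}^{n\times l}$ have as columns orthonormal bases of $\mathbf{A}$, $\mathbf{B}$. The principal angles are $\theta_i(\mathbf{A},\mathbf{B}) = \cos^{-1}\sigma_i(A^{\mathsf T}B)\in[0,\pi/2]$, $i=1,\dots,\min(k,l)$, where $\sigma_1\ge\sigma_2\ge\cdots$ are the singular values of $A^{\mathsf T}B$; thus $\theta_1\le\theta_2\le\cdots$. They do not depend on the choice of bases. Grassmann distance: for $\mathbf{A},\mathbf{B}\in\operatorname{Gr}(k,n)$, $d_{\operatorname{Gr}(k,n)}(\mathbf{A},\mathbf{B}) = \bigl(\sum_{i=1}^k\theta_i(\mathbf{A},\mathbf{B})^2\bigr)^{1/2}$ (this is the geodesic distance). For $\mathbf{A}\in\operatorname{Gr}(k,n)$, $\mathbf{B}\in\operatorname{Gr}(l,n)$ with $k\le l\le n$: $\Omega_{+}(\mathbf{A}) = \{\mathbf{X}\in\operatorname{Gr}(l,n): \mathbf{A}\subseteq\mathbf{X}\}$ and $\Omega_{-}(\mathbf{B}) = \{\mathbf{Y}\in\operatorname{Gr}(k,n): \mathbf{Y}\subseteq\mathbf{B}\}$. For a point $x$ and subset $S$ of a metric space $(X,d)$, $d(x,S)=\inf\{d(x,y):y\in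 S\}$; here the infima are attained since the sets are compact. *)

(* Defs.v *)
From mathcomp Require Export all_boot all_order all_algebra.
From mathcomp Require Export polyrcf.
From mathcomp Require Export all_classical all_reals all_analysis.
Set Implicit Arguments.
Unset Strict Implicit.
Unset Printing Implicit Defensive.
Import Order.TTheory GRing.Theory Num.Theory.
Local Open Scope classical_set_scope.
Local Open Scope ring_scope.

(* The nonincreasing sequence of the singular values of M, with multiplicity.
   M^T *m M has q eigenvalues; for p < q at least q - p of them vanish, and
   these are dropped by [take]. *)
Definition singular_values (R : realType) (p q : nat) (M : 'M[R]_(p, q)) :
    seq R :=
  let chi := char_poly (M^T *m M) in
  let eigenvalues := flatten [seq nseq (mup x chi) x | x <- rootsR chi] in
  take (minn p q) (sort >=%R [seq Num.sqrt x | x <- eigenvalues]).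

Definition orthonormal_basis (R : realType) (n k : nat)
    (W : {vspace 'cV[R]_n}) (M : 'M[R]_(n, k)) : Prop :=
  M^T *m M = 1%:M /\ basis_of W [seq col j M | j <- enum 'I_k].

(* An arbitrary orthonormal basis of W; the principal angles do not depend on
   the choice. *)
Definition onb (R : realType) (n : nat) (W : {vspace 'cV[R]_n}) :
    'M[R]_(n, \dim W) :=
  xget 0 [set M | orthonormal_basis W M].

(* Indices are shifted: [principal_angle V W i] is the angle theta_(i+1). *)
Definition principal_angle (R : realType) (n : nat)
    (V W : {vspace 'cV[R]_n}) (i : nat) : R :=
  acos (singular_values ((onb V)^T *m onb W))`_i.

Definition Gr (R : realType) (k n : nat) : set {vspace 'cV[R]_n} :=
  [set W | \dim W = k].
Arguments Gr : clear implicits.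

(* Only meaningful for V and W in [Gr R k n]. *)
Definition dGr (R : realType) (k n : nat) (V W : {vspace 'cV[R]_n}) : R :=
  Num.sqrt (\sum_(i < k) principal_angle V W i ^+ 2).

Definition Omega_plus (R : realType) (l n : nat) (A : {vspace 'cV[R]_n}) :
    set {vspace 'cV[R]_n} :=
  [set X | Gr R l n X /\ (A <= X)%VS].

Definition Omega_minus (R : realType) (k n : nat) (B : {vspace 'cV[R]_n}) :
    set {vspace 'cV[R]_n} :=
  [set Y | Gr R k n Y /\ (Y <= B)%VS].

Definition dist_to_set (R : realType) (T : Type) (d : T -> T -> R) (x : T)
    (S : set T) : R :=
  inf [set d x y | y in S].

(* For \dim A <= \dim B. *)
Definition delta (R : realType) (n : nat) (A B : {vspace 'cV[R]_n}) : R :=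
  dist_to_set (@dGr R (\dim A) n) A (Omega_minus (\dim A) B).

(* The image of W under x |-> (x, 0). *)
Definition extend (R : realType) (n p : nat) (W : {vspace 'cV[R]_n}) :
    {vspace 'cV[R]_(n + p)} :=
  (linfun (fun x : 'cV[R]_n => col_mx x (0 : 'cV[R]_p)) @: W)%VS.

(* Main.v *)
(* Both minima are read off from interlacing of singular values.  If
   Y <= B has orthonormal basis matrix B Q, then A^T Y is (A^T B) Q, so its i-th
   singular value is at most that of A^T B.  If A = X Q for a basis matrix X of
   a space containing A, then B^T A is (B^T X) Q with l - k fewer columns than
   B^T X, so the (i + l - k)-th singular value of B^T X is at most the i-th one
   of A^T B.  As acos is decreasing, both distances are at least
   (sum_i theta_i(A, B)^2)^(1/2).  With principal vectors a_i, b_j, i.e.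
   a_i . b_j = 0 for i <> j and a_i . b_i = cos theta_i, equality holds for
   Y = span(b_1, ..., b_k) and X = span(a_1, ..., a_k, b_(k+1), ..., b_l). *)
Require Import Defs.
From HB Require Import structures.
From mathcomp Require Import ring lra zify.
Set Implicit Arguments.
Unset Strict Implicit.
Unset Printing Implicit Defensive.
Import Order.TTheory GRing.Theory Num.Theory.
Local Open Scope classical_set_scope.
Local Open Scope ring_scope.

(** * Squared norms, matrices with orthonormal columns, and the top singular pair *)

Definition sqnorm (R : realType) n (x : 'cV[R]_n) : R := \sum_i x i 0 ^+ 2.

Definition isomx (R : realType) p q (M : 'M[R]_(p, q)) : Prop :=
  M^T *m M = 1%:M.

Section SquaredNorm.
Import numFieldNormedType.Exports.
Variable R : realType.

Lemma sqnormE n (x : 'cV[R]_n) : sqnorm x = (x^T *m x) 0 0.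
Proof. by rewrite mxE; apply: eq_bigr => i _; rewrite mxE expr2. Qed.

Lemma sqnorm_ge0 n (x : 'cV[R]_n) : 0 <= sqnorm x.
Proof. by apply: sumr_ge0 => i _; rewrite sqr_ge0. Qed.

Lemma sqnorm_eq0 n (x : 'cV[R]_n) : (sqnorm x == 0) = (x == 0).
Proof.
rewrite psumr_eq0; last by move=> i _; rewrite sqr_ge0.
apply/allP/eqP => [x0|-> i _]; last by apply/implyP => _; rewrite mxE expr0n.
apply/colP => i; rewrite mxE; apply/eqP; rewrite -sqrf_eq0.
by apply: x0 (mem_index_enum i).
Qed.

Lemma sqnormZ n c (x : 'cV[R]_n) : sqnorm (c *: x) = c ^+ 2 * sqnorm x.
Proof.
by rewrite mulr_sumr; apply: eq_bigr => i _; rewrite mxE exprMn.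
Qed.

Lemma sqnorm0 n : sqnorm (0 : 'cV[R]_n) = 0.
Proof. by apply/eqP; rewrite sqnorm_eq0. Qed.

Lemma dot_colC n (x y : 'cV[R]_n) : (x^T *m y) 0 0 = (y^T *m x) 0 0.
Proof. by rewrite -[in LHS](trmxK y) -trmx_mul mxE. Qed.

Lemma sqnormD n (x y : 'cV[R]_n) :
  sqnorm (x + y) = sqnorm x + (x^T *m y) 0 0 *+ 2 + sqnorm y.
Proof.
rewrite /sqnorm mxE -sumrMnl -!big_split /=.
by apply: eq_bigr => i _; rewrite !mxE; ring.
Qed.

Lemma sqnorm_isom p q (M : 'M[R]_(p, q)) (x : 'cV[R]_q) :
  isomx M -> sqnorm (M *m x) = sqnorm x.
Proof.
by move=> Mi; rewrite !sqnormE trmx_mul -mulmxA (mulmxA M^T) Mi mul1mx.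
Qed.

Lemma isomxM p q r (M : 'M[R]_(p, q)) (N : 'M[R]_(q, r)) :
  isomx M -> isomx N -> isomx (M *m N).
Proof.
by move=> Mi Ni; rewrite /isomx trmx_mul -mulmxA (mulmxA M^T) Mi mul1mx.
Qed.

Lemma isomx1 p : isomx (1%:M : 'M[R]_p).
Proof. by rewrite /isomx trmx1 mulmx1. Qed.

Lemma isomxT p (M : 'M[R]_p) : isomx M -> isomx M^T.
Proof. by rewrite /isomx trmxK; exact: mulmx1C. Qed.

Lemma isomx_inj p q r (M : 'M[R]_(p, q)) (x y : 'M[R]_(q, r)) :
  isomx M -> M *m x = M *m y -> x = y.
Proof.
by move=> Mi /(congr1 (mulmx M^T)); rewrite !mulmxA Mi !mul1mx.
Qed.

(* [x = M (M^T x) + (x - M (M^T x))] is an orthogonal decomposition. *)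
Lemma sqnorm_isom_tr p q (M : 'M[R]_(p, q)) (x : 'cV[R]_p) :
  isomx M -> sqnorm (M^T *m x) <= sqnorm x.
Proof.
move=> Mi; rewrite -[in leRHS](subrKC (M *m (M^T *m x)) x) sqnormD.
rewrite (sqnorm_isom _ Mi) trmx_mul -mulmxA mulmxBr (mulmxA M^T M) Mi mul1mx.
by rewrite subrr mulmx0 mxE mul0rn addr0 lerDl sqnorm_ge0.
Qed.

Lemma continuous_sqnorm_mulmx p q (M : 'M[R]_(p, q)) :
  continuous (fun x : 'rV[R]_q => sqnorm (M *m x^T)).
Proof.
pose f j := fun x : 'rV[R]_q => (M *m x^T) j 0.
have cf j : continuous (f j).
  have -> : f j = fun x => \sum_i M j i * x 0 i.
    by apply/funext => x; rewrite /f mxE; apply: eq_bigr => i _; rewrite mxE.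
  apply: continuous_big => [|i _ x]; first exact: add_continuous.
  by apply: continuousM; [exact: cst_continuous | exact: coord_continuous].
apply: continuous_big => [|j _ x]; first exact: add_continuous.
by rewrite /continuous_at; apply: continuousM; exact: cf.
Qed.

(** The maximum of |M v|^2 over the compact unit sphere, carried to all x by homogeneity. The sphere
    consists of row vectors to fit [bounded_closed_compact]. *)
Lemma top_singular_vector p q (M : 'M[R]_(p, q.+1)) :
  exists2 v : 'cV[R]_q.+1, sqnorm v = 1 &
    forall x, sqnorm (M *m x) <= sqnorm (M *m v) * sqnorm x.
Proof.
pose S := [set x : 'rV[R]_q.+1 | sqnorm x^T = 1].
have cS : compact S.
  apply: bounded_closed_compact.
    exists 1; split=> // c c1 x xS; apply: le_trans (ltW c1).
    rewrite /Num.norm /= mx_normrE; apply/bigmax_leP; split=> // -[i j] _ /=.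
    rewrite -(@ler_pXn2r _ 2) ?nnegrE ?normr_ge0// real_normK ?num_real//.
    rewrite expr1n -xS ord1 /sqnorm (bigD1 j)//= mxE lerDl.
    by apply: sumr_ge0 => k _; rewrite sqr_ge0.
  have -> : S = (fun x => sqnorm (1%:M *m x^T)) @^-1` [set x | x = 1].
    by apply/seteqP; split=> x; rewrite /S /= mul1mx.
  have /continuous_closedP := @continuous_sqnorm_mulmx _ q.+1 1%:M.
  by apply; exact: closed_eq.
have S0 : S !=set0.
  exists (delta_mx 0 0); rewrite /S /= /sqnorm (bigD1 0)//= !mxE eqxx expr1n.
  rewrite big1 ?addr0// => i i0; rewrite !mxE (negbTE i0) andbF.
  by rewrite expr0n.
have [|v vS vmax] := @compact_EVT_max _ R (fun x => sqnorm (M *m x^T)) S S0 cS.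
  exact/continuous_subspaceT/continuous_sqnorm_mulmx.
move: vS; rewrite inE => vS.
exists v^T => // x; have [->|x0] := eqVneq x 0.
  by rewrite mulmx0 !sqnorm0 mulr0.
have nx0 : 0 < sqnorm x by rewrite lt_def sqnorm_eq0 x0 sqnorm_ge0.
pose c := (Num.sqrt (sqnorm x))^-1.
have c2 : c ^+ 2 = (sqnorm x)^-1 by rewrite exprVn sqr_sqrtr// sqnorm_ge0.
have := vmax (c *: x)^T; rewrite inE /S /= !trmxK !sqnormZ c2 mulVf ?gt_eqF//.
move=> /(_ erefl); rewrite -scalemxAr sqnormZ c2 mulrC.
by rewrite ler_pdivrMr.
Qed.

(** First-order optimality: a quadratic that vanishes at 0 and is nonnegative has zero slope
    there. *)
Lemma ge0_quad_linear0 (b c : R) :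
  (forall t, 0 <= (t * b) *+ 2 + t ^+ 2 * c) -> b = 0.
Proof.
(* At this t the quadratic is a square times c - 2 (|c| + 1) < 0; the added 1 avoids a case split on
   c = 0. *)
move=> H; have := H (- b / (`|c| + 1)).
have c1 : 0 < `|c| + 1 by rewrite ltr_wpDl.
have -> : (- b / (`|c| + 1) * b) *+ 2 + (- b / (`|c| + 1)) ^+ 2 * c
   = (b / (`|c| + 1)) ^+ 2 * (c - 2 * (`|c| + 1)).
  by field; rewrite gt_eqF.
have c3 : c - 2 * (`|c| + 1) < 0 by have := ler_norm c; lra.
rewrite nmulr_lge0// => b0; have : (b / (`|c| + 1)) ^+ 2 == 0.
  by rewrite eq_le b0 sqr_ge0.
by rewrite sqrf_eq0 mulf_eq0 invr_eq0 (gt_eqF c1) orbF => /eqP.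
Qed.

(** A maximiser v of |M v| on the sphere is an eigenvector of M^T M, so u = M v / s closes the pair.
    If s = 0 then M = 0 and any unit vector serves as u. *)
Lemma top_singular_pair p q (M : 'M[R]_(p.+1, q.+1)) :
  exists u v s, [/\ sqnorm u = 1 /\ sqnorm v = 1, 0 <= s,
    M *m v = s *: u, M^T *m u = s *: v &
    forall x, sqnorm (M *m x) <= s ^+ 2 * sqnorm x].
Proof.
have [v v1 vmax] := top_singular_vector M.
pose s := Num.sqrt (sqnorm (M *m v)).
have s2 : s ^+ 2 = sqnorm (M *m v) by rewrite sqr_sqrtr// sqnorm_ge0.
have eig : M^T *m (M *m v) = s ^+ 2 *: v.
  rewrite s2; set L := sqnorm _.
  suff H (w : 'cV_q.+1) : (w^T *m (L *: v - M^T *m (M *m v))) 0 0 = 0.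
    apply/esym/eqP; rewrite -subr_eq0 -sqnorm_eq0 sqnormE.
    by rewrite H.
  (* Perturb v to v + t w: L |v + t w|^2 - |M (v + t w)|^2 is nonnegative, has no constant term
     since L = |M v|^2, and its linear coefficient is twice the inner product to be killed. *)
  apply: (@ge0_quad_linear0 _ (L * sqnorm w - sqnorm (M *m w))) => t.
  have := vmax (v + t *: w).
  rewrite -/L mulmxDr -scalemxAr !sqnormD !sqnormZ v1 -/L -subr_ge0.
  congr (0 <= _).
  have -> : (v^T *m (t *: w)) 0 0 = t * (w^T *m v) 0 0.
    by rewrite -scalemxAr mxE dot_colC.
  have -> : ((M *m v)^T *m (t *: (M *m w))) 0 0
     = t * (w^T *m (M^T *m (M *m v))) 0 0.
    rewrite -scalemxAr mxE; congr (_ * _).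
    by rewrite dot_colC trmx_mul -mulmxA.
  rewrite mulmxBr -scalemxAr !mxE; ring.
have [s0|s0] := eqVneq s 0.
  have M0 (x : 'cV_q.+1) : M *m x = 0.
    apply/eqP; rewrite -sqnorm_eq0 eq_le sqnorm_ge0 andbT.
    by rewrite (le_trans (vmax x))// -s2 s0 expr0n mul0r.
  have {M0}M0 : M = 0.
    apply/matrixP => i j; have := congr1 (fun N : 'cV_p.+1 => N i 0) (M0 (delta_mx j 0)).
    by rewrite -colE !mxE.
  exists (delta_mx 0 0), v, 0; split=> //.
  - by rewrite sqnormE trmx_delta mul_delta_mx mxE !eqxx.
  - by rewrite M0 mul0mx scale0r.
  - by rewrite M0 trmx0 mul0mx scale0r.
  - by move=> x; rewrite M0 mul0mx sqnorm0 mulr_ge0 ?sqr_ge0// sqnorm_ge0.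
exists (s^-1 *: (M *m v)), v, s; split=> //.
- by split; rewrite // sqnormZ -s2 exprVn mulVf// sqrf_eq0.
- by rewrite sqrtr_ge0.
- by rewrite scalerA mulfV// scale1r.
- by rewrite -scalemxAr eig scalerA expr2 mulrA mulVf// mul1r.
- by move=> x; rewrite s2.
Qed.

(* The reflection exchanging [v] and the first basis vector. *)
Lemma isomx_col0 q (v : 'cV[R]_q.+1) : sqnorm v = 1 ->
  exists2 Q : 'M[R]_q.+1, isomx Q & Q *m delta_mx 0 0 = v.
Proof.
move=> v1; pose e : 'cV[R]_q.+1 := delta_mx 0 0.
have [ve|ve] := eqVneq v e.
  by exists 1%:M; [exact: isomx1 | rewrite mul1mx ve].
pose w := v - e; pose a := v 0 0.
have e1 : sqnorm e = 1 by rewrite sqnormE trmx_delta mul_delta_mx mxE !eqxx.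
have we : (w^T *m e) 0 0 = a - 1 by rewrite -colE !mxE.
have ww : sqnorm w = 2 * (1 - a).
  rewrite /w addrC sqnormD v1 -(scaleN1r e) sqnormZ e1.
  rewrite linearZ /= -scalemxAl trmx_delta mxE.
  by rewrite -rowE mxE -/a; ring.
have a1 : 1 - a != 0.
  have : sqnorm w != 0 by rewrite sqnorm_eq0 subr_eq0.
  by rewrite ww mulf_eq0 negb_or => /andP[].
(* Householder's factor 2 / |w|^2, as |w|^2 = 2 (1 - a). *)
pose c := (1 - a)^-1.
pose N := w *m w^T; exists (1%:M - c *: N).
  have NT : (1%:M - c *: N)^T = 1%:M - c *: N.
    by rewrite linearB /= trmx1 linearZ /= trmx_mul trmxK.
  have NN : N *m N = (2 * (1 - a)) *: N.
    rewrite /N mulmxA -(mulmxA w) (mx11_scalar (w^T *m w)) -sqnormE ww.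
    by rewrite mul_mx_scalar -scalemxAl.
  rewrite /isomx NT mulmxBr mulmx1 -scalemxAr mulmxBl mul1mx -scalemxAl NN.
  rewrite scalerBr !scalerA (_ : c * c * _ = c *+ 2); last by rewrite /c; field.
  by rewrite mulr2n scalerDl opprB addrK subrK.
rewrite mulmxBl mul1mx -scalemxAl -mulmxA (mx11_scalar (w^T *m _)) we.
rewrite mul_mx_scalar scalerA (_ : c * _ = -1); last by rewrite /c; field.
by rewrite scaleN1r opprK /w subrKC.
Qed.

End SquaredNorm.

(** * Singular value decomposition *)

Definition diag_rect (R : realType) p q (d : nat -> R) : 'M[R]_(p, q) :=
  \matrix_(i, j) (d i *+ (i == j :> nat)).
Arguments diag_rect {R} p q d.

Section SVD.
Variable R : realType.
Implicit Types d e : nat -> R.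

Lemma tr_diag_rect p q d : (diag_rect p q d)^T = diag_rect q p d.
Proof.
by apply/matrixP => i j; rewrite !mxE eq_sym; case: eqP => // ->.
Qed.

Lemma eq_diag_rect p q d e : (forall i, (i < minn p q)%N -> d i = e i) ->
  diag_rect p q d = diag_rect p q e.
Proof.
move=> de; apply/matrixP => i j; rewrite !mxE; case: eqP => // ij.
by rewrite de// leq_min ltn_ord ij ltn_ord.
Qed.

(** Diagonals are sequences over [nat], so that one d fits every shape. The hypothesis ensures that
    the middle dimension cuts off no diagonal entry. *)
Lemma mul_diag_rect p q r d e : (minn p r <= q)%N ->
  diag_rect p q d *m diag_rect q r e = diag_rect p r (fun i => d i * e i).
Proof.
move=> prq; apply/matrixP => i k; rewrite !mxE.
have [ik|ik] := eqVneq (i : nat) k; last first.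
  rewrite big1// => j _; rewrite !mxE.
  case: eqP => [ij|_]; last by rewrite mul0r.
  by rewrite -ij (negbTE ik) mulr0.
have iq : (i < q)%N by have := ltn_ord k; have := ltn_ord i; lia.
rewrite (bigD1 (Ordinal iq))//= big1 ?addr0 => [|j ji].
  by rewrite !mxE /= eqxx ik eqxx !mulr1n.
rewrite !mxE (_ : (i == j :> nat) = false) ?mul0r//.
by apply/negbTE; apply: contra ji => /eqP kj; apply/eqP/val_inj; rewrite /= kj.
Qed.

Lemma diag_rect1 p : diag_rect p p (fun=> 1 : R) = 1%:M.
Proof. by apply/matrixP => i j; rewrite !mxE. Qed.

Lemma isomx_diag_rect1 p q : (q <= p)%N ->
  isomx (diag_rect p q (fun=> 1 : R)).
Proof.
move=> qp; rewrite /isomx tr_diag_rect mul_diag_rect ?minnn//.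
by rewrite -diag_rect1; apply: eq_diag_rect => i _; rewrite mulr1.
Qed.

(** For p < q the diagonal of this q by q matrix is zero from index p on, hence the factor
    [*+ (i < p)]. *)
Lemma gram_diag_rect p q d : (diag_rect p q d)^T *m diag_rect p q d =
  diag_rect q q (fun i => (d i *+ (i < p)%N) ^+ 2).
Proof.
apply/matrixP => i k; rewrite !mxE.
under eq_bigr do rewrite !mxE.
have [ip|ip] := ltnP i p; last first.
  rewrite expr0n mul0rn big1// => j _; rewrite (_ : (_ == _) = false) ?mul0r//.
  by have := ltn_ord j; lia.
rewrite (bigD1 (Ordinal ip))//= eqxx big1 ?addr0 => [|j ji].
  by case: eqP; rewrite ?mulr0// mulr1n expr2.
rewrite (_ : (j == i :> nat) = false) ?mul0r//.
by apply/negbTE; apply: contra ji => /eqP kj; apply/eqP/val_inj.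
Qed.

Lemma sqnorm_delta n (i : 'I_n) : sqnorm (delta_mx i 0 : 'cV[R]_n) = 1.
Proof. by rewrite sqnormE trmx_delta mul_delta_mx mxE !eqxx. Qed.

Lemma sqnorm_svd_col p q (U : 'M[R]_p) (V : 'M[R]_q) d (i : 'I_q) :
  isomx U -> isomx V ->
  sqnorm ((U *m diag_rect p q d *m V^T) *m (V *m delta_mx i 0)) =
  (d i *+ (i < p)%N) ^+ 2.
Proof.
move=> Ui Vi; rewrite -!mulmxA (mulmxA V^T) Vi mul1mx (sqnorm_isom _ Ui).
rewrite sqnormE trmx_mul -!mulmxA (mulmxA (diag_rect _ _ _)^T) gram_diag_rect.
by rewrite trmx_delta -rowE mxE -colE !mxE eqxx.
Qed.

(** Deflation: once a singular pair sits at the first basis vectors, the first row and column vanish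
    off the diagonal. *)
Lemma block_mx_e0 p q s (N : 'M[R]_(1 + p, 1 + q)) :
  N *m (delta_mx 0 0 : 'cV[R]_q.+1) = s *: (delta_mx 0 0 : 'cV[R]_p.+1) ->
  N^T *m (delta_mx 0 0 : 'cV[R]_p.+1) = s *: (delta_mx 0 0 : 'cV[R]_q.+1) ->
  N = block_mx s%:M 0 0 (drsubmx N).
Proof.
move=> Ncol Nrow.
rewrite -[LHS]submxK; congr block_mx.
- apply/matrixP => i j; have := congr1 (fun X : 'cV_p.+1 => X 0 0) Ncol.
  rewrite -colE !mxE !ord1 !eqxx mulr1 mulr1n => <-.
  by congr (N _ _); apply/val_inj.
- apply/matrixP => i j; have := congr1 (fun X : 'cV_q.+1 => X (rshift 1 j) 0) Nrow.
  rewrite -colE !mxE !ord1 [rshift 1 _ == 0](_ : _ = false) // mulr0 => <-.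
  by congr (N _ _); apply/val_inj.
- apply/matrixP => i j; have := congr1 (fun X : 'cV_p.+1 => X (rshift 1 i) 0) Ncol.
  rewrite -colE !mxE !ord1 [rshift 1 _ == 0](_ : _ = false) // mulr0 => <-.
  by congr (N _ _); apply/val_inj.
Qed.

Lemma isomx_block1 p (U : 'M[R]_p) : isomx U ->
  isomx (block_mx (1%:M : 'M[R]_1) 0 0 U).
Proof.
move=> Ui; rewrite /isomx tr_block_mx mulmx_block.
by rewrite !trmx0 trmx1 !mulmx0 !mul0mx !addr0 !add0r mulmx1 Ui -scalar_mx_block.
Qed.

(** Induction by deflation: orthogonal P and Q move a top singular pair of M to the first basis
    vectors, and the remaining block is decomposed by induction. *)
Lemma svd p q (M : 'M[R]_(p, q)) : exists U V d,
  [/\ isomx U, isomx V, forall i, 0 <= d i,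
      forall i j, (i <= j)%N -> d j <= d i &
      M = U *m diag_rect p q d *m V^T].
Proof.
elim: p q M => [|p IHp] q M.
  exists 1%:M, 1%:M, (fun=> 0); split=> //; try exact: isomx1.
  by apply/matrixP => -[].
case: q M => [|q] M.
  exists 1%:M, 1%:M, (fun=> 0); split=> //; try exact: isomx1.
  by apply/matrixP => i [].
have [u [v [s [[u1 v1] s0 Mv Mu smax]]]] := top_singular_pair M.
have [P Pi Pu] := isomx_col0 u1.
have [Q Qi Qv] := isomx_col0 v1.
have Pu' : P^T *m u = delta_mx 0 0 by rewrite -Pu mulmxA Pi mul1mx.
have Qv' : Q^T *m v = delta_mx 0 0 by rewrite -Qv mulmxA Qi mul1mx.
pose N : 'M[R]_(1 + p, 1 + q) := P^T *m M *m Q.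
have NE : N = block_mx s%:M 0 0 (drsubmx N).
  have Ncol : N *m (delta_mx 0 0 : 'cV[R]_q.+1) = s *: (delta_mx 0 0 : 'cV[R]_p.+1).
    by rewrite /N -!mulmxA Qv Mv -scalemxAr Pu'.
  have Nrow : N^T *m (delta_mx 0 0 : 'cV[R]_p.+1) = s *: (delta_mx 0 0 : 'cV[R]_q.+1).
    by rewrite /N !trmx_mul trmxK -!mulmxA Pu Mu -scalemxAr Qv'.
  exact: block_mx_e0.
have [U' [V' [d' [U'i V'i d'0 d'dec N'E]]]] := IHp q (drsubmx N).
(* A singular vector y of the block, padded with a zero to z, is subject to the maximality of s. *)
have d's i : (i < minn p q)%N -> d' i <= s.
  rewrite leq_min => /andP[ip iq].
  rewrite -(@ler_pXn2r _ 2) ?nnegrE//.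
  have := sqnorm_svd_col d' (Ordinal iq) U'i V'i.
  rewrite -N'E /= ip mulr1n => <-.
  set y := V' *m _; have y1 : sqnorm y = 1.
    by rewrite (sqnorm_isom _ V'i) sqnorm_delta.
  pose z : 'cV[R]_(1 + q) := col_mx 0 y.
  have sz (r : nat) (x : 'cV[R]_r) : sqnorm (col_mx (0 : 'cV_1) x) = sqnorm x.
    by rewrite !sqnormE tr_col_mx mul_row_col mulmx0 add0r.
  have := smax (Q *m z); rewrite (sqnorm_isom _ Qi) sz y1 mulr1.
  have Nz : N *m z = col_mx 0 (drsubmx N *m y).
    by rewrite [N in LHS]NE /z mul_block_col !mulmx0 mul0mx !add0r.
  have -> : sqnorm (M *m (Q *m z)) = sqnorm (N *m z).
    by rewrite /N -!mulmxA (sqnorm_isom _ (isomxT Pi)).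
  by rewrite Nz sz.
(* The minimum with s changes nothing below [minn p q], by [d's]; it keeps d nonincreasing at the
   later indices, where d' is not controlled. *)
pose d i : R := if i is i'.+1 then Num.min s (d' i') else s.
pose U : 'M[R]_(1 + p) := block_mx 1%:M 0 0 U'.
pose V : 'M[R]_(1 + q) := block_mx 1%:M 0 0 V'.
exists (P *m U), (Q *m V), d; split.
- exact/(isomxM Pi)/isomx_block1.
- exact/(isomxM Qi)/isomx_block1.
- by case=> [|i] //=; rewrite le_min s0 d'0.
- case=> [|i] [|j]//= ij; first by rewrite ge_min lexx.
  by rewrite le_min !ge_min lexx d'dec ?orbT.
have dE : diag_rect (1 + p) (1 + q) d = block_mx s%:M 0 0 (diag_rect p q d').
  rewrite -[LHS]submxK; congr block_mx; apply/matrixP => i j; rewrite !mxE//=.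
  - by rewrite !ord1.
  - by rewrite !ord1.
  - by rewrite !ord1.
  - rewrite /= !add1n eqSS /=; case: eqP => // ij; rewrite min_r// d's//.
    by rewrite leq_min ltn_ord ij ltn_ord.
have <- : P *m N *m Q^T = M.
  by rewrite /N !mulmxA (mulmx1C Pi) mul1mx -mulmxA (mulmx1C Qi) mulmx1.
have -> : N = U *m diag_rect (1 + p) (1 + q) d *m V^T.
  rewrite NE N'E dE /U /V tr_block_mx !mulmx_block.
  by rewrite !trmx0 trmx1 !mulmx0 !mul0mx !addr0 !add0r mulmx1 !mul1mx !mul0mx.
by rewrite trmx_mul !mulmxA.
Qed.

Lemma char_poly_isom q (V A : 'M[R]_q) : isomx V ->
  char_poly (V *m A *m V^T) = char_poly A.
Proof.
move=> Vi; rewrite /char_poly /char_poly_mx !map_mxM /=.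
set W := map_mx _ V; set W' := map_mx _ V^T; set B := map_mx _ A.
have WW : W *m W' = 1%:M by rewrite -map_mxM (mulmx1C Vi) map_mx1.
have -> : 'X%:M - W *m B *m W' = W *m ('X%:M - B) *m W'.
  by rewrite mulmxBr mulmxBl scalar_mxC -(mulmxA 'X%:M) WW mulmx1.
by rewrite !det_mulmx mulrAC -det_mulmx WW det1 mul1r.
Qed.

(** Each x has the same count on both sides: its multiplicity as a root of chi. *)
Lemma perm_eigenvalues (s : seq R) (chi : {poly R}) :
  chi = \prod_(x <- s) ('X - x%:P) ->
  perm_eq (flatten [seq nseq (mup x chi) x | x <- rootsR chi]) s.
Proof.
move=> chiE; have chi0 : chi != 0.
  by rewrite chiE monic_neq0// monic_prod_XsubC.
apply/allP => x _ /=; apply/eqP.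
rewrite -[RHS]mu_prod_XsubC -chiE count_flatten -map_comp.
have cE y : (count_mem x \o (fun x => nseq (mup x chi) x)) y =
    if y == x then mup x chi else 0%N.
  by rewrite /= count_nseq /=; case: eqP => [->|_]; rewrite ?mul1n ?mul0n.
rewrite (eq_map cE) sumnE big_map -big_mkcond /=.
have -> : (\sum_(i <- rootsR chi | i == x) mup x chi =
    count_mem x (rootsR chi) * mup x chi)%N.
  by rewrite big_const_seq iter_addn_0 mulnC.
rewrite count_uniq_mem ?uniq_roots//; have := roots_on_rootsR chi0 x.
rewrite in_itv /= => <-.
case: (boolP (root chi x)) => [_|rx]; first by rewrite mul1n.
by rewrite mul0n mupNroot.
Qed.

(** Links the definition through eigenvalues to decompositions: the Gram matrix is orthogonally
    similar to a diagonal one, whose entries are then read off its characteristic polynomial. *)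
Lemma singular_values_svd p q (U : 'M[R]_p) (V : 'M[R]_q) d :
  isomx U -> isomx V -> (forall i, 0 <= d i) ->
  (forall i j, (i <= j)%N -> d j <= d i) ->
  singular_values (U *m diag_rect p q d *m V^T) = mkseq d (minn p q).
Proof.
move=> Ui Vi d0 ddec; rewrite /singular_values.
(* The q eigenvalues are the squares of e, that is, of d replaced by 0 from index p on; the final
   [take] drops these zeros. *)
set e := fun i => d i *+ (i < p)%N.
have e0 i : 0 <= e i by rewrite /e mulrn_wge0.
set chi := char_poly _.
have chiE : chi = \prod_(x <- [seq e i ^+ 2 | i <- iota 0 q]) ('X - x%:P).
  rewrite /chi !trmx_mul trmxK -!mulmxA (mulmxA U^T) Ui mul1mx.
  rewrite (mulmxA _^T) gram_diag_rect mulmxA char_poly_isom// char_poly_trig.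
    rewrite big_map -[q in iota 0 q]subn0 big_mkord.
    by apply: eq_bigr => i _; rewrite mxE eqxx mulr1n.
  apply/is_trig_mxP => i j ij; rewrite mxE (_ : (_ == _) = false)//.
  by lia.
have /(perm_map Num.sqrt) := perm_eigenvalues chiE.
move/(perm_sortP (@ge_total _ R) ge_trans ge_anti) => ->.
rewrite -map_comp (eq_map (_ : Num.sqrt \o _ =1 e)); last first.
  by move=> i /=; rewrite sqrtr_sqr ger0_norm.
rewrite sorted_sort; last first.
- rewrite sorted_map; apply: (sub_sorted _ (iota_sorted 0 q)) => i j ij /=.
  rewrite /e; have [jp|_] := ltnP j p; last by rewrite mulr0n mulrn_wge0.
  by rewrite (leq_ltn_trans ij jp) ddec.
- exact: ge_trans.
rewrite -map_take take_iota -/(mkseq _ _).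
have -> : minn (minn p q) q = minn p q by lia.
apply/eq_in_map => i; rewrite mem_iota add0n leq_min => /andP[_ /andP[ip _]].
by rewrite /e ip.
Qed.

End SVD.

(** * Interlacing of singular values *)

Definition shift_mx (R : realType) q r s : 'M[R]_(q, r) :=
  \matrix_(i, j) (i == s + j :> nat)%N%:R.
Arguments shift_mx {R} q r s.

Section Interlacing.
Variable R : realType.
Implicit Types d e : nat -> R.

(** [shift_mx q r s] embeds R^r as the coordinates s, ..., s + r - 1 of R^q. *)
Lemma isomx_shift_mx q r s : (s + r <= q)%N -> isomx (shift_mx q r s : 'M[R]_(q, r)).
Proof.
move=> srq; apply/matrixP => i j; rewrite !mxE.
have iq : (s + i < q)%N by have := ltn_ord i; lia.
rewrite (bigD1 (Ordinal iq))//= big1 ?addr0 => [|t tj]; rewrite !mxE /=.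
  by rewrite eqxx eqn_add2l mul1r.
rewrite (_ : (_ == _ + i)%N = false) ?mul0r//.
by apply/negbTE; apply: contra tj => /eqP tE; apply/eqP/val_inj.
Qed.

Lemma sqnorm_diag_rect p q d (y : 'cV[R]_q) :
  sqnorm (diag_rect p q d *m y) =
  \sum_(i < q) (d i *+ (i < p)%N) ^+ 2 * y i 0 ^+ 2.
Proof.
rewrite sqnormE trmx_mul -mulmxA (mulmxA (diag_rect _ _ _)^T) gram_diag_rect mxE.
apply: eq_bigr => i _; rewrite !mxE (bigD1 i)//= !mxE eqxx mulr1n.
rewrite big1 ?addr0 => [|j ji]; first by ring.
by rewrite mxE eq_sym (negbTE ji : (j == i :> nat) = false) mulr0n mul0r.
Qed.

(* The ranges of [P] and [T] meet by dimension count; compare the two bounds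
   at a common vector. *)
Lemma sqnorm_bounds_le p q a b (M : 'M[R]_(p, q)) (P : 'M[R]_(q, a))
    (T : 'M[R]_(q, b)) c c' : isomx P -> isomx T -> (q < a + b)%N ->
  (forall y, c * sqnorm y <= sqnorm (M *m (P *m y))) ->
  (forall z, sqnorm (M *m (T *m z)) <= c' * sqnorm z) -> c <= c'.
Proof.
move=> Pi Ti qab lo up; pose K := (row_mx P (- T))^T.
have : kermx K != 0.
  rewrite -mxrank_eq0 mxrank_ker subn_eq0 -ltnNge.
  by apply: leq_ltn_trans qab; exact: rank_leq_col.
case/rowV0Pn => w /sub_kermxP wK w0.
pose y := usubmx w^T; pose z := dsubmx w^T.
have PT : P *m y = T *m z.
  apply/eqP; rewrite -subr_eq0 -mulNmx -mul_row_col vsubmxK.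
  by rewrite -(trmxK (row_mx _ _)) -trmx_mul -/K wK trmx0.
have yz : sqnorm y = sqnorm z.
  by rewrite -(sqnorm_isom _ Pi) PT (sqnorm_isom _ Ti).
have y0 : 0 < sqnorm y.
  rewrite lt_def sqnorm_ge0 andbT sqnorm_eq0; apply: contra w0 => /eqP y0.
  have /eqP : sqnorm z = 0 by rewrite -yz y0 sqnorm0.
  rewrite sqnorm_eq0 => /eqP z0.
  by rewrite -(trmxK w) -(vsubmxK w^T) -/y -/z y0 z0 col_mx0 trmx0.
rewrite -(ler_pM2r y0); apply: le_trans (lo y) _.
by rewrite PT yz.
Qed.

(** Courant-Fischer argument. On the image under P of the first i + 1 right singular vectors of M P,
    |M x| >= d_i |x|; on the image under T of those of M T from index j on, |M x| <= e_j |x|. The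
    dimensions i + 1 and b - j add up to more than q. *)
Lemma svd_interlace p q a b (M : 'M[R]_(p, q)) (P : 'M[R]_(q, a))
    (T : 'M[R]_(q, b)) (U1 : 'M[R]_p) (V1 : 'M[R]_a) d (U2 : 'M[R]_p)
    (V2 : 'M[R]_b) e i j :
  isomx P -> isomx T ->
  isomx U1 -> isomx V1 -> isomx U2 -> isomx V2 ->
  (forall n, 0 <= d n) -> (forall m n, (m <= n)%N -> d n <= d m) ->
  (forall n, 0 <= e n) -> (forall m n, (m <= n)%N -> e n <= e m) ->
  M *m P = U1 *m diag_rect p a d *m V1^T ->
  M *m T = U2 *m diag_rect p b e *m V2^T ->
  (i < minn p a)%N -> (j < b)%N -> (q < i.+1 + (b - j))%N -> d i <= e j.
Proof.
move=> Pi Ti U1i V1i U2i V2i d0 ddec e0 edec MP MT.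
rewrite leq_min => /andP[ip ia] jb qij.
rewrite -(@ler_pXn2r _ 2) ?nnegrE//.
apply: (@sqnorm_bounds_le p q i.+1 (b - j) M
  (P *m (V1 *m diag_rect a i.+1 (fun=> 1))) (T *m (V2 *m shift_mx b (b - j) j))).
- by apply: isomxM => //; apply: isomxM => //; exact: isomx_diag_rect1.
- do 2!apply: isomxM => //.
  by apply: isomx_shift_mx; rewrite subnKC// ltnW.
- by [].
- move=> y; rewrite !mulmxA MP -(mulmxA _ _ V1) V1i mulmx1.
  rewrite -(mulmxA U1) mul_diag_rect ?geq_min ?ia ?orbT//.
  rewrite -mulmxA (sqnorm_isom _ U1i) sqnorm_diag_rect mulr_sumr.
  apply: ler_sum => k _; apply: ler_wpM2r; first exact: sqr_ge0.
  have ki : (k <= i)%N by rewrite -ltnS.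
  by rewrite (leq_ltn_trans ki ip) mulr1 mulr1n ler_pXn2r ?nnegrE ?ddec.
- move=> z; rewrite !mulmxA MT -(mulmxA _ _ V2) V2i mulmx1 -!mulmxA.
  rewrite (sqnorm_isom _ U2i) sqnorm_diag_rect.
  have <- : sqnorm (shift_mx b (b - j) j *m z) = sqnorm z.
    by apply/sqnorm_isom/isomx_shift_mx; rewrite subnKC// ltnW.
  rewrite mulr_sumr; apply: ler_sum => k _.
  (* From index j on the values are at most e j; below j the shifted vector has zero coordinates. *)
  have [jk|kj] := leqP j k.
    apply: ler_wpM2r; first exact: sqr_ge0.
    case: (k < p)%N => /=; last by rewrite mulr0n expr0n sqr_ge0.
    by rewrite mulr1n ler_pXn2r ?nnegrE ?edec.
  rewrite (_ : (_ *m z) k 0 = 0) ?expr0n ?mulr0//.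
  rewrite mxE big1// => s _; rewrite mxE (_ : (_ == _) = false) ?mul0r//.
  by apply/negbTE; lia.
Qed.

(** Cosines are at most 1: d_i is the norm of A^T applied to a unit vector in the range of B, and
    A^T does not increase norms. *)
Lemma svd_le1 n k l (A : 'M[R]_(n, k)) (B : 'M[R]_(n, l)) (U : 'M[R]_k)
    (V : 'M[R]_l) d i :
  isomx A -> isomx B -> isomx U -> isomx V -> (forall n, 0 <= d n) ->
  A^T *m B = U *m diag_rect k l d *m V^T -> (i < minn k l)%N -> d i <= 1.
Proof.
move=> Ai Bi Ui Vi d0 AB; rewrite leq_min => /andP[ik il].
rewrite -(@ler_pXn2r _ 2) ?nnegrE// expr1n.
have := sqnorm_svd_col d (Ordinal il) Ui Vi; rewrite /= ik mulr1n => <-.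
rewrite -AB -mulmxA; apply: le_trans (sqnorm_isom_tr _ Ai) _.
by rewrite (sqnorm_isom _ Bi) (sqnorm_isom _ Vi) sqnorm_delta.
Qed.

End Interlacing.

(** * Orthonormal bases and independence of the angles from their choice *)

Section OrthonormalBases.
Variable R : realType.

(** Turns the basis condition into a statement on the range of M; freeness follows from the
    injectivity of an isometry and a dimension count. *)
Lemma orthonormal_basisP n k (W : {vspace 'cV[R]_n}) (M : 'M[R]_(n, k)) :
  orthonormal_basis W M <->
  isomx M /\ forall x, x \in W <-> exists y, x = M *m y.
Proof.
pose X := [seq col j M | j <- enum 'I_k].
pose f := linfun (mulmx M : 'cV[R]_k -> 'cV[R]_n).
have spanE : <<X>>%VS = limg f.
  apply/eqP; rewrite eqEsubv; apply/andP; split.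
    apply/span_subvP => _ /mapP[j _ ->]; apply/memv_imgP.
    by exists (delta_mx j 0); rewrite ?memvf// lfunE /= colE.
  apply/subvP => _ /memv_imgP[y _ ->]; rewrite lfunE /=.
  have -> : M *m y = \sum_j y j 0 *: col j M.
    apply/colP => i; rewrite mxE summxE; apply: eq_bigr => j _.
    by rewrite !mxE mulrC.
  apply: memv_suml => j _; apply/memvZ/memv_span/mapP.
  by exists j; rewrite ?mem_enum.
have limgP x : x \in limg f <-> exists y, x = M *m y.
  split=> [/memv_imgP[y _ ->]|[y ->]]; first by exists y; rewrite lfunE.
  by apply/memv_imgP; exists y; rewrite ?memvf ?lfunE.
split=> [[Mi /andP[/eqP XW _]]|[Mi WP]]; split=> //.
  by move=> x; rewrite -XW spanE.
have fW : limg f = W.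
  by apply/vspaceP => x; apply/idP/idP; [move/limgP/WP | move/WP/limgP].
rewrite /basis_of spanE fW eqxx /= /free spanE size_map size_enum_ord.
have := limg_ker_dim f fullv; rewrite (_ : (_ :&: _)%VS = 0%VS).
  by rewrite dimv0 add0n dimvf dim_matrix mulr1 => ->.
apply/eqP; rewrite -subv0; apply/subvP => y; rewrite memv_cap memv_ker.
rewrite lfunE /= => /andP[_ /eqP My]; rewrite memv0; apply/eqP.
by apply: (isomx_inj Mi); rewrite mulmx0.
Qed.

Lemma dim_orthonormal_basis n k (W : {vspace 'cV[R]_n}) (M : 'M[R]_(n, k)) :
  orthonormal_basis W M -> \dim W = k.
Proof.
case=> _ /andP[/eqP <- /eqP ->].
by rewrite size_map size_enum_ord.
Qed.

Lemma orthonormal_basis_limg n k (M : 'M[R]_(n, k)) : isomx M ->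
  orthonormal_basis (limg (linfun (mulmx M : 'cV[R]_k -> 'cV[R]_n))) M.
Proof.
move=> Mi; apply/orthonormal_basisP; split=> // x; split.
  by move=> /memv_imgP[y _ ->]; exists y; rewrite lfunE.
by move=> [y ->]; apply/memv_imgP; exists y; rewrite ?memvf ?lfunE.
Qed.

(** Q is B^T A, since B B^T fixes every vector of W. For V = W it is the orthogonal change of
    basis. *)
Lemma orthonormal_basis_subv n k l (V W : {vspace 'cV[R]_n})
    (A : 'M[R]_(n, k)) (B : 'M[R]_(n, l)) :
  orthonormal_basis V A -> orthonormal_basis W B -> (V <= W)%VS ->
  exists2 Q : 'M[R]_(l, k), isomx Q & A = B *m Q.
Proof.
move=> /orthonormal_basisP[Ai VP] /orthonormal_basisP[Bi WP] /subvP VW.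
have BA : B *m (B^T *m A) = A.
  apply/matrixP => i j; have /VW/WP[y Ay] : A *m delta_mx j 0 \in V.
    by apply/VP; exists (delta_mx j 0).
  have : B *m (B^T *m A) *m delta_mx j 0 = A *m delta_mx j 0 :> 'cV_n.
    by rewrite -!mulmxA Ay (mulmxA B^T) Bi mul1mx.
  by rewrite -!colE => /colP/(_ i); rewrite !mxE.
exists (B^T *m A) => //.
by rewrite /isomx trmx_mul trmxK -mulmxA BA.
Qed.

Lemma orthonormal_basis_mulr n k (W : {vspace 'cV[R]_n}) (M : 'M[R]_(n, k))
    (G : 'M[R]_k) :
  orthonormal_basis W M -> isomx G -> orthonormal_basis W (M *m G).
Proof.
move=> /orthonormal_basisP[Mi WP] Gi; apply/orthonormal_basisP; split.
  exact: isomxM.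
move=> x; split=> [/WP[y ->]|[y ->]]; last by apply/WP; exists (G *m y); rewrite mulmxA.
by exists (G^T *m y); rewrite mulmxA -(mulmxA M) (mulmx1C Gi) mulmx1.
Qed.

(* Take left singular vectors of a matrix of basis vectors of [W]. *)
Lemma orthonormal_basis_ex n (W : {vspace 'cV[R]_n}) :
  exists M : 'M[R]_(n, \dim W), orthonormal_basis W M.
Proof.
set k := \dim W; pose b := vbasis W.
pose Z : 'M[R]_(n, k) := \matrix_(i, j) (b`_j : 'cV[R]_n) i 0.
have ZE (y : 'cV_k) : Z *m y = \sum_(j < k) y j 0 *: b`_j.
  apply/colP => i; rewrite mxE summxE; apply: eq_bigr => j _.
  by rewrite !mxE mulrC.
have Z0 (y : 'cV_k) : Z *m y = 0 -> y = 0.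
  have /freeP bfree := basis_free (vbasisP W).
  rewrite ZE => /(bfree (fun j => y j 0)) y0.
  by apply/colP => j; rewrite y0 mxE.
have ZW x : x \in W <-> exists y, x = Z *m y.
  split=> [xW|[y ->]].
    exists (\col_j coord b j x); rewrite ZE {1}(coord_vbasis xW).
    by apply: eq_bigr => j _; rewrite mxE.
  rewrite ZE; apply: memv_suml => j _; apply/memvZ/vbasis_mem/mem_nth.
  by rewrite size_tuple.
have [U [V [d [Ui Vi d0 ddec ZD]]]] := svd Z.
have kn : (k <= n)%N.
  by rewrite -[n]mulr1 -(dim_matrix R n 1) -dimvf dimvS ?subvf.
have dn0 i : (i < k)%N -> d i != 0.
  move=> ik; apply/eqP => di0.
  have := sqnorm_svd_col d (Ordinal ik) Ui Vi.
  rewrite -ZD /= di0 mul0rn expr0n /= => /eqP; rewrite sqnorm_eq0 => /eqP/Z0.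
  move/(congr1 (@sqnorm R k)); rewrite (sqnorm_isom _ Vi) sqnorm_delta sqnorm0.
  by move/eqP; rewrite oner_eq0.
(* The first k columns of U. As no d i vanishes, M and Z differ by an invertible right factor and
   have the same range. *)
pose M := U *m diag_rect n k (fun=> 1).
have ZM : Z = M *m (diag_rect k k d *m V^T).
  rewrite ZD /M -!mulmxA; congr (_ *m _); rewrite mulmxA mul_diag_rect ?geq_minr//.
  by congr (_ *m _); apply: eq_diag_rect => i _; rewrite mul1r.
have MZ : M = Z *m (V *m diag_rect k k (fun i => (d i)^-1)).
  rewrite ZM -!mulmxA (mulmxA V^T) Vi mul1mx mul_diag_rect ?minnn//.
  rewrite (@eq_diag_rect _ _ _ _ (fun=> 1)) ?diag_rect1 ?mulmx1// => i.
  by rewrite minnn => ik; rewrite mulfV ?dn0.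
exists M; apply/orthonormal_basisP; split.
  by apply: isomxM => //; exact: isomx_diag_rect1.
move=> x; split=> [/ZW[y ->]|[y ->]].
  by rewrite ZM -mulmxA; eexists.
by apply/ZW; rewrite MZ -mulmxA; eexists.
Qed.

Lemma onbP n (W : {vspace 'cV[R]_n}) : orthonormal_basis W (onb W).
Proof.
by have [M WM] := orthonormal_basis_ex W; exact: (xgetPex 0 (ex_intro _ M WM)).
Qed.

(** Passing from A, B to the chosen bases multiplies A^T B by orthogonal matrices on both sides,
    which are absorbed into U and T. *)
Lemma principal_angle_svd n k l (V W : {vspace 'cV[R]_n}) (A : 'M[R]_(n, k))
    (B : 'M[R]_(n, l)) (U : 'M[R]_k) (T : 'M[R]_l) d i :
  orthonormal_basis V A -> orthonormal_basis W B ->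
  isomx U -> isomx T -> (forall n, 0 <= d n) ->
  (forall m n, (m <= n)%N -> d n <= d m) ->
  A^T *m B = U *m diag_rect k l d *m T^T -> (i < minn k l)%N ->
  principal_angle V W i = acos (d i).
Proof.
move=> VA WB; have ek := dim_orthonormal_basis VA; have el := dim_orthonormal_basis WB.
subst k l => Ui Ti d0 ddec AB ikl.
have [Q Qi VE] := orthonormal_basis_subv (onbP V) VA (subvv V).
have [S Si WE] := orthonormal_basis_subv (onbP W) WB (subvv W).
rewrite /principal_angle {1}VE WE trmx_mul -mulmxA (mulmxA A^T) AB.
have -> : Q^T *m (U *m diag_rect (\dim V) (\dim W) d *m T^T *m S) =
    (Q^T *m U) *m diag_rect (\dim V) (\dim W) d *m (S^T *m T)^T.
  by rewrite trmx_mul trmxK !mulmxA.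
rewrite singular_values_svd ?nth_mkseq//; apply: isomxM => //; exact: isomxT.
Qed.

End OrthonormalBases.

(** * Principal vectors and the two minimal distances *)

Section Distances.
Variable R : realType.

Lemma acos_anti (s t : R) : 0 <= s -> s <= t -> t <= 1 ->
  0 <= acos t <= acos s.
Proof.
move=> s0 st t1.
have t11 : -1 <= t <= 1 by rewrite t1 andbT; lra.
have s11 : -1 <= s <= 1 by apply/andP; split; lra.
rewrite acos_ge0//= leNgt -ltr_cos ?in_itv/= ?acos_ge0 ?acos_lepi//.
by rewrite !acosK ?in_itv//= -leNgt.
Qed.

Lemma acos_sqr_le (s t : R) : 0 <= s -> s <= t -> t <= 1 ->
  acos t ^+ 2 <= acos s ^+ 2.
Proof.
move=> s0 st t1; have /andP[t0 ts] := acos_anti s0 st t1.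
by rewrite ler_pXn2r ?nnegrE// (le_trans t0).
Qed.

Lemma dist_to_set_min (T : Type) (f : T -> T -> R) (x y : T) (S : set T) :
  S y -> (forall z, S z -> f x y <= f x z) -> dist_to_set f x S = f x y.
Proof.
move=> Sy ymin; apply/le_anti/andP; split.
  apply: ge_inf; last by exists y.
  by exists (f x y) => _ [z Sz <-]; exact: ymin.
apply: lb_le_inf; first by exists (f x y), y.
by move=> _ [z Sz <-]; exact: ymin.
Qed.

(** Principal vectors: the singular vectors of A^T B, used as changes of basis, make it diagonal. *)
Lemma principal_bases n (V W : {vspace 'cV[R]_n}) :
  let k := \dim V in let l := \dim W in
  exists (A : 'M[R]_(n, k)) (B : 'M[R]_(n, l)) (d : nat -> R),
  [/\ orthonormal_basis V A, orthonormal_basis W B,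
      A^T *m B = diag_rect k l d, forall i, 0 <= d i &
      forall i j, (i <= j)%N -> d j <= d i].
Proof.
move=> k l; have [A VA] := orthonormal_basis_ex V.
have [B WB] := orthonormal_basis_ex W.
have [U [T [d [Ui Ti d0 ddec AB]]]] := svd (A^T *m B).
exists (A *m U), (B *m T), d; split=> //.
- exact: orthonormal_basis_mulr.
- exact: orthonormal_basis_mulr.
rewrite trmx_mul -mulmxA (mulmxA A^T) AB !mulmxA Ui mul1mx -mulmxA.
by rewrite Ti mulmx1.
Qed.

Lemma principal_angle_diag n k l (V W : {vspace 'cV[R]_n}) (A : 'M[R]_(n, k))
    (B : 'M[R]_(n, l)) d i :
  orthonormal_basis V A -> orthonormal_basis W B ->
  A^T *m B = diag_rect k l d -> (forall n, 0 <= d n) ->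
  (forall m n, (m <= n)%N -> d n <= d m) -> (i < minn k l)%N ->
  principal_angle V W i = acos (d i).
Proof.
move=> VA WB AB d0 ddec.
apply: (principal_angle_svd VA WB (isomx1 R k) (isomx1 R l)) => //.
by rewrite trmx1 mulmx1 mul1mx.
Qed.

Lemma dGr_diag n k (V W : {vspace 'cV[R]_n}) (A B : 'M[R]_(n, k)) d :
  orthonormal_basis V A -> orthonormal_basis W B ->
  A^T *m B = diag_rect k k d -> (forall n, 0 <= d n) ->
  (forall m n, (m <= n)%N -> d n <= d m) ->
  dGr k V W = Num.sqrt (\sum_(i < k) acos (d i) ^+ 2).
Proof.
move=> VA WB AB d0 ddec; congr Num.sqrt; apply: eq_bigr => i _.
by rewrite (principal_angle_diag VA WB AB d0 ddec)// minnn.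
Qed.

Section PrincipalVectors.
Variables (n k l : nat) (V W : {vspace 'cV[R]_n}).
Variables (A : 'M[R]_(n, k)) (B : 'M[R]_(n, l)) (d : nat -> R).
Hypotheses (VA : orthonormal_basis V A) (WB : orthonormal_basis W B).
Hypotheses (AB : A^T *m B = diag_rect k l d) (d0 : forall i, 0 <= d i).
Hypotheses (ddec : forall i j, (i <= j)%N -> d j <= d i).
Hypotheses (k_gt0 : (0 < k)%N) (le_kl : (k <= l)%N).

Let Ai : isomx A. Proof. by case: VA. Qed.
Let Bi : isomx B. Proof. by case: WB. Qed.
Let D := Num.sqrt (\sum_(i < k) acos (d i) ^+ 2).

(** The bound at index 0, a true cosine because k > 0, spreads to all indices by monotonicity. *)
Lemma principal_cos_le1 i : d i <= 1.
Proof.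
apply: le_trans (ddec (leq0n i)) _.
apply: (@svd_le1 R n k l A B 1%:M 1%:M) => //; try exact: isomx1.
  by rewrite trmx1 mulmx1 mul1mx.
by rewrite leq_min k_gt0 (leq_trans k_gt0).
Qed.

Let d1 := principal_cos_le1.

Lemma Omega_minus_lb Y : Omega_minus k W Y -> D <= dGr k V Y.
Proof.
move=> [dimY YW]; have [Y0 YY0] := orthonormal_basis_ex Y.
move: Y0 YY0; rewrite dimY => Y0 YY0.
have [Q Qi Y0E] := orthonormal_basis_subv YY0 WB YW.
have [U [T [t [Ui Ti t0 tdec AY]]]] := svd (A^T *m Y0).
have Y0i : isomx Y0 by case: YY0.
apply: ler_wsqrtr; apply: ler_sum => i _.
rewrite (principal_angle_svd VA YY0 Ui Ti t0 tdec AY) ?minnn//.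
apply: acos_sqr_le => //.
(* The two subspaces compared have dimensions i + 1 and l - i, in total l + 1. *)
apply: (@svd_interlace R k l k l (A^T *m B) Q 1%:M U T t 1%:M 1%:M d) => //;
  try exact: isomx1.
- by rewrite -mulmxA -Y0E.
- by rewrite trmx1 !mulmx1 mul1mx.
- by rewrite minnn.
- exact: leq_trans le_kl.
- by have := ltn_ord i; lia.
Qed.

Lemma Omega_minus_attained : exists2 Y, Omega_minus k W Y & dGr k V Y = D.
Proof.
pose Y0 := B *m diag_rect l k (fun=> 1).
have Y0i : isomx Y0 by apply: isomxM => //; exact: isomx_diag_rect1.
have YY0 := orthonormal_basis_limg Y0i.
exists (limg (linfun (mulmx Y0 : 'cV[R]_k -> 'cV[R]_n))).
  split; first exact: dim_orthonormal_basis YY0.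
  apply/subvP => _ /memv_imgP[y _ ->]; rewrite lfunE /=.
  by apply/((orthonormal_basisP _ _).1 WB).2; rewrite -mulmxA; eexists.
rewrite (@dGr_diag _ _ _ _ A Y0 d)// mulmxA AB mul_diag_rect; last by rewrite minnn.
by apply: eq_diag_rect => i _; rewrite mulr1.
Qed.

Lemma Omega_plus_lb X : Omega_plus l V X -> D <= dGr l W X.
Proof.
move=> [dimX VX]; have [X0 XX0] := orthonormal_basis_ex X.
move: X0 XX0; rewrite dimX => X0 XX0.
have [Q Qi AE] := orthonormal_basis_subv VA XX0 VX.
have [U [T [t [Ui Ti t0 tdec BX]]]] := svd (B^T *m X0).
apply: ler_wsqrtr.
rewrite (eq_bigr (fun i : 'I_l => acos (t i) ^+ 2)); last first.
  by move=> i _; rewrite (principal_angle_svd WB XX0 Ui Ti t0 tdec BX)// minnn.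
rewrite -(big_mkord predT (fun i => acos (t i) ^+ 2)).
(* The first l - k squared angles are discarded; the angle at i + (l - k) is then compared with the
   one at i between V and W. *)
rewrite (big_cat_nat (n := l - k)) ?leq_subr//=.
apply: ler_wpDl; first by apply: sumr_ge0 => i _; rewrite sqr_ge0.
rewrite -[(l - k)%N]add0n big_addn subKn// big_mkord.
apply: ler_sum => i _; apply: acos_sqr_le => //.
(* Here the dimensions are i + (l - k) + 1 and k - i, again l + 1 in total. *)
apply: (@svd_interlace R l l l k (B^T *m X0) 1%:M Q U T t 1%:M 1%:M d) => //;
  try exact: isomx1.
- by rewrite mulmx1.
- by rewrite -mulmxA -AE -[LHS]trmxK trmx_mul trmxK AB tr_diag_rect trmx1 mulmx1 mul1mx.
- by rewrite minnn; have := ltn_ord i; lia.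
- by have := ltn_ord i; lia.
Qed.

End PrincipalVectors.

(** The dimension l is written m + k to allow block matrices. Bases of W and X both start with the m
    shared vectors b_(k+1), ..., b_l, so the cosines, m ones followed by d, are nonincreasing as
    [dGr_diag] demands. *)
Lemma Omega_plus_attained_addn n k m (V W : {vspace 'cV[R]_n})
    (A : 'M[R]_(n, k)) (B : 'M[R]_(n, m + k)) d :
  orthonormal_basis V A -> orthonormal_basis W B ->
  A^T *m B = diag_rect k (m + k) d -> (forall i, 0 <= d i <= 1) ->
  (forall i j, (i <= j)%N -> d j <= d i) ->
  exists2 X, Omega_plus (m + k) V X &
    dGr (m + k) W X = Num.sqrt (\sum_(i < k) acos (d i) ^+ 2).
Proof.
move=> VA WB AB d01 ddec.
have Ai : isomx A by case: VA.
have Bi : isomx B by case: WB.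
pose E : 'M[R]_(m + k, m) := shift_mx (m + k) m k.
pose F : 'M[R]_(m + k, k) := diag_rect (m + k) k (fun=> 1).
have Ei : isomx E by apply: isomx_shift_mx; rewrite addnC.
have Fi : isomx F by apply: isomx_diag_rect1; rewrite leq_addl.
have diagE e : diag_rect k (m + k) e *m E = 0.
  apply/matrixP => i j; rewrite !mxE big1// => t _; rewrite !mxE.
  have [it|_] := eqVneq (i : nat) t; last by rewrite mulr0n mul0r.
  rewrite (_ : (_ == _) = false) ?mulr0//.
  by have := ltn_ord i; lia.
have FE : F^T *m E = 0 by rewrite tr_diag_rect diagE.
have EF : E^T *m F = 0 by rewrite -[LHS]trmxK trmx_mul trmxK FE trmx0.
(* B G is B with its last m columns moved to the front. *)
pose G := row_mx E F.
have Gi : isomx G.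
  rewrite /isomx tr_row_mx mul_col_row Ei Fi FE EF.
  by rewrite -scalar_mx_block.
have WG := orthonormal_basis_mulr WB Gi.
pose X0 := row_mx (B *m E) A.
have ABE : A^T *m (B *m E) = 0 by rewrite mulmxA AB diagE.
have BEA : (B *m E)^T *m A = 0 by rewrite -[LHS]trmxK trmx_mul trmxK ABE trmx0.
have BEi : isomx (B *m E) by exact: isomxM.
have X0i : isomx X0.
  rewrite /isomx tr_row_mx mul_col_row BEi Ai ABE BEA.
  by rewrite -scalar_mx_block.
have XX0 := orthonormal_basis_limg X0i.
pose e i : R := if (i < m)%N then 1 else d (i - m)%N.
exists (limg (linfun (mulmx X0 : 'cV[R]_(m + k) -> 'cV[R]_n))).
  split; first exact: dim_orthonormal_basis XX0.
  apply/subvP => x /((orthonormal_basisP _ _).1 VA).2[y ->].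
  apply/((orthonormal_basisP _ _).1 XX0).2; exists (col_mx 0 y).
  by rewrite mul_row_col mulmx0 add0r.
rewrite (@dGr_diag _ _ _ _ _ _ e WG XX0).
- congr Num.sqrt; rewrite big_split_ord /= big1 ?add0r.
    by apply: eq_bigr => i _; rewrite /e ltnNge leq_addr /= addKn.
  by move=> i _; rewrite /e ltn_ord acos1 expr0n.
- have FB : (B *m F)^T *m A = diag_rect k k d.
    rewrite -[LHS]trmxK trmx_mul trmxK mulmxA AB mul_diag_rect ?minnn ?leq_addl//.
    by rewrite tr_diag_rect; apply: eq_diag_rect => i _; rewrite mulr1.
  have FBE : (B *m F)^T *m (B *m E) = 0.
    by rewrite trmx_mul -mulmxA (mulmxA B^T) Bi mul1mx.
  have -> : B *m G = row_mx (B *m E) (B *m F) by rewrite mul_mx_row.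
  rewrite /X0 tr_row_mx mul_col_row BEi BEA FBE FB.
  rewrite -[RHS]submxK; congr block_mx; apply/matrixP => i j; rewrite !mxE /=.
  + by rewrite /e ltn_ord.
  + by rewrite (_ : (_ == _) = false)//; have := ltn_ord i; lia.
  + by rewrite (_ : (_ == _) = false)//; have := ltn_ord j; lia.
  + by rewrite eqn_add2l /e ltnNge leq_addr /= addKn.
- by move=> i; rewrite /e; case: ifP => // _; case/andP: (d01 (i - m)%N).
- move=> i j ij; rewrite /e; have [jm|mj] := ltnP j m.
    by rewrite (leq_ltn_trans ij jm).
  case: ifP => _; first by case/andP: (d01 (j - m)%N).
  by apply: ddec; rewrite leq_sub2r.
Qed.

Section Delta.
Variables (n k l : nat) (V W : {vspace 'cV[R]_n}).
Hypotheses (dimV : \dim V = k) (dimW : \dim W = l).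
Hypotheses (k_gt0 : (0 < k)%N) (le_kl : (k <= l)%N).
Let D := Num.sqrt (\sum_(i < k) principal_angle V W i ^+ 2).

Lemma Omega_dists :
  [/\ exists2 Y, Omega_minus k W Y & dGr k V Y = D,
      forall Y, Omega_minus k W Y -> D <= dGr k V Y,
      exists2 X, Omega_plus l V X & dGr l W X = D &
      forall X, Omega_plus l V X -> D <= dGr l W X].
Proof.
have := principal_bases V W; rewrite dimV dimW /=.
case=> A [B [d [VA WB AB d0 ddec]]].
have -> : D = Num.sqrt (\sum_(i < k) acos (d i) ^+ 2).
  congr Num.sqrt; apply: eq_bigr => i _.
  by rewrite (principal_angle_diag VA WB AB d0 ddec)// (minn_idPl le_kl).
split.
- exact: (Omega_minus_attained VA WB AB).
- exact: (Omega_minus_lb VA WB AB).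
- have d1 := principal_cos_le1 VA WB AB d0 ddec k_gt0 le_kl.
  (* Recasts the column count of B as (l - k) + k. *)
  have lE := subnK le_kl.
  move: B WB AB; rewrite -lE => B' WB' AB'.
  by apply: (Omega_plus_attained_addn VA WB' AB') => // i; rewrite d0 d1.
- exact: (Omega_plus_lb VA WB AB).
Qed.

Lemma dist_Omega_minus : dist_to_set (@dGr R k n) V (Omega_minus k W) = D.
Proof.
have [[Y WY <-] lb _ _] := Omega_dists.
by apply: dist_to_set_min WY _ => Z /lb; case: Omega_dists.
Qed.

Lemma dist_Omega_plus : dist_to_set (@dGr R l n) W (Omega_plus l V) = D.
Proof.
have [_ _ [X VX XD] lb] := Omega_dists.
by rewrite -XD; apply: dist_to_set_min VX _ => Z /lb; rewrite XD.
Qed.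

Lemma deltaE : delta V W = D.
Proof. by rewrite /delta dimV dist_Omega_minus. Qed.

End Delta.

(** * Independence of the ambient dimension *)

Lemma orthonormal_basis_extend n k p (V : {vspace 'cV[R]_n})
    (A : 'M[R]_(n, k)) :
  orthonormal_basis V A -> orthonormal_basis (extend p V) (col_mx A (0 : 'M[R]_(p, k))).
Proof.
move=> /orthonormal_basisP[Ai VP]; apply/orthonormal_basisP; split.
  by rewrite /isomx tr_col_mx mul_row_col Ai mulmx0 addr0.
pose f := fun x : 'cV[R]_n => col_mx x (0 : 'cV[R]_p).
have f_lin : linear f.
  by move=> c x y; rewrite /f scale_col_mx add_col_mx scaler0 addr0.
(* [extend] applies [linfun] to a bare function; evaluating it by [lfunE] takes the linear structure
   packed here. *)
pose g : {linear 'cV[R]_n -> 'cV[R]_(n + p)} :=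
  HB.pack f (GRing.isLinear.Build R _ _ _ f f_lin).
have fE x : linfun f x = col_mx x 0 by exact: (lfunE g).
move=> x; split=> [/memv_imgP[_ /VP[y ->]]|[y ->]].
  by rewrite fE => ->; exists y; rewrite mul_col_mx mul0mx.
apply/memv_imgP; exists (A *m y); first by apply/VP; exists y.
by rewrite fE mul_col_mx mul0mx.
Qed.

(** Padding both bases with zero rows leaves A^T B, hence every principal angle, unchanged. *)
Lemma delta_extend n p (V W : {vspace 'cV[R]_n}) :
  (0 < \dim V)%N -> (\dim V <= \dim W)%N ->
  delta (extend p V) (extend p W) = delta V W.
Proof.
move=> V0 VW; have [A [B [d [VA WB AB d0 ddec]]]] := principal_bases V W.
have VA' := orthonormal_basis_extend p VA.
have WB' := orthonormal_basis_extend p WB.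
have AB' : (col_mx A (0 : 'M[R]_(p, _)))^T *m col_mx B (0 : 'M[R]_(p, _)) =
    diag_rect (\dim V) (\dim W) d.
  by rewrite tr_col_mx mul_row_col mulmx0 addr0.
rewrite (deltaE (dim_orthonormal_basis VA') (dim_orthonormal_basis WB'))//.
rewrite (deltaE (erefl (\dim V)) (erefl (\dim W)))//.
congr Num.sqrt; apply: eq_bigr => i _.
rewrite (principal_angle_diag VA' WB' AB' d0 ddec) ?(minn_idPl VW)//.
by rewrite (principal_angle_diag VA WB AB d0 ddec) ?(minn_idPl VW).
Qed.

End Distances.

Theorem theorem7 (R : realType) (k l n : nat) (A B : {vspace 'cV[R]_n})
    (k_gt0 : (0 < k)%N) (le_kl : (k <= l)%N) (le_ln : (l <= n)%N)
    (hA : Gr R k n A) (hB : Gr R l n B) :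
  [/\ delta A B = dist_to_set (@dGr R k n) A (Omega_minus k B) /\
      delta A B = dist_to_set (@dGr R l n) B (Omega_plus l A),
      (exists2 Y, Omega_minus k B Y &
        dGr k A Y = dist_to_set (@dGr R k n) A (Omega_minus k B)) /\
      (exists2 X, Omega_plus l A X &
        dGr l B X = dist_to_set (@dGr R l n) B (Omega_plus l A)),
      forall p : nat, delta (extend p A) (extend p B) = delta A B,
      k = l -> delta A B = dGr k A B
    & delta A B = Num.sqrt (\sum_(i < minn k l) principal_angle A B i ^+ 2)].
Proof.
have [minY _ minX _] := Omega_dists hA hB k_gt0 le_kl.
rewrite (deltaE hA hB) // (dist_Omega_minus hA hB) // (dist_Omega_plus hA hB) //.
(* The clause for k = l closes by conversion: [dGr k A B] unfolds to the same root of a sum over the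
   first k angles. *)
split=> //; last by rewrite (minn_idPl le_kl).
by move=> p; rewrite delta_extend ?hA ?hB// (deltaE hA hB).
Qed.
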